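(* Let $K \subseteq \mathbb{R}^n$ be an origin symmetric convex body. Then there exists a linear subspace $U \subseteq \mathbb{R}^n$ (possibly $U = \mathbb{R}^n$) such that $d_{BM}(K \cap U, \mathbb{B}^n \cap U) = d_{BM}(K,\mathbb{B}^n)$ and the pair of distance ellipsoids for $K \cap U$ (relative to $U$) is unique.
   Context: A convex body in $\mathbb{R}^n$ is a compact convex set with non-empty interior; it is origin symmetric if $K=-K$, and symmetric if some translate of it is origin symmetric. $\mathbb{B}^n$ is the closed Euclidean unit ball of $\mathbb{R}^n$. The Banach-Mazur distance of convex bodies $K,L\subseteq\mathbb{R}^n$ is $d_{BM}(K,L)=\inf\{\rho>0 : K+u\subseteq T(L+v)\subseteq\rho(K+u)\}$, where the infimum is over all invertible linear operators $T:\mathbb{R}^n\to\mathbb{R}^n$ and vectors $u,v\in\mathbb{R}^n$. For a linear subspace $U$, $d_{BM}(K\cap U,\mathbb{B}^n\cap U)$ is the Banach-Mazur distance of these two sets regarded as convex bodies in $U$ (i.e. $U$ plays the role of the ambient space). A pair of ellipsoids $(E_1,E_2)$ in $\mathbb{R}^n$ is a pair of distance ellipsoids for a symmetric convex body $K\subseteq\mathbb{R}^n$ if $E_1\subseteq K\subseteq E_2$ and $E_1,E_2$ are homothetic with ratio $d_{BM}(K,\mathbb{B}^n)$, i.e. $E_2$ is a translate of $d_{BM}(K,\mathbb{B}^n)\,E_1$; ellipsoids may have arbitrary centers and $E_1,E_2$ need not be concentric. For $K\cap U$ the notion is understood within $U$: the ellipsoids are ellipsoids in $U$ (full-dimensional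 in $U$) and the ratio is $d_{BM}(K\cap U,\mathbb{B}^n\cap U)$. *)

(* Defs.v *)
From HB Require Import structures.
From mathcomp Require Import all_boot all_order all_algebra.
From mathcomp Require Import all_classical all_reals all_analysis.

Set Implicit Arguments.
Unset Strict Implicit.
Unset Printing Implicit Defensive.

Import Order.TTheory GRing.Theory Num.Theory numFieldNormedType.Exports.
Local Open Scope classical_set_scope.
Local Open Scope ring_scope.

Definition translate (R : realType) (V : lmodType R) (u : V) (A : set V) :
  set V := [set x + u | x in A].

Definition dilate (R : realType) (V : lmodType R) (rho : R) (A : set V) :
  set V := [set rho *: x | x in A].

Definition convex_body (R : realType) (n : nat) (K : set 'rV[R]_n) : Prop :=
  [/\ convex_set (K : set (convex_lmodType 'rV[R]_n)), compact K & K° !=set0].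

Definition origin_symmetric (R : realType) (V : lmodType R) (K : set V) : Prop :=
  K = [set - x | x in K].

(* The library norm on 'rV[R]_n is the sup norm, so the Euclidean ball is
   written out in coordinates. *)
Definition euclidean_ball (R : realType) (n : nat) : set 'rV[R]_n :=
  [set x : 'rV[R]_n | \sum_(i < n) (x ord0 i) ^+ 2 <= 1].
Arguments euclidean_ball : clear implicits.

(* The ambient space V is a parameter: for a subspace U, the distance of bodies
   "in U" is obtained with V := subvs_of U, so that T, u, v all live in U. *)
Definition banach_mazur (R : realType) (V : vectType R) (K L : set V) : R :=
  inf [set rho : R | 0 < rho /\
    exists T : 'End(V), bijective T /\
    exists u v : V,
      translate u K `<=` T @` translate v L /\
      T @` translate v L `<=` dilate rho (translate u K)].

(* A :&: U, as a set in U. *)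
Definition section_in (R : realType) (n : nat) (U : {vspace 'rV[R]_n})
    (A : set 'rV[R]_n) : set (subvs_of U) :=
  [set x | A (vsval x)].
Arguments section_in {R n} U A.

(* Full-dimensional in U: T is an invertible operator of U. *)
Definition ellipsoid (R : realType) (n : nat) (U : {vspace 'rV[R]_n})
    (E : set (subvs_of U)) : Prop :=
  exists T : 'End(subvs_of U), bijective T /\
  exists c : subvs_of U,
    E = translate c (T @` section_in U (euclidean_ball R n)).

Definition distance_ellipsoids (R : realType) (n : nat)
    (U : {vspace 'rV[R]_n}) (K : set (subvs_of U))
    (E : set (subvs_of U) * set (subvs_of U)) : Prop :=
  [/\ ellipsoid E.1, ellipsoid E.2, E.1 `<=` K, K `<=` E.2 &
    exists c : subvs_of U,
      E.2 = translate c
        (dilate (banach_mazur K (section_in U (euclidean_ball R n))) E.1)].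

(* Main.v *)
Require Import Defs.
From HB Require Import structures.
From mathcomp Require Import all_boot all_order all_algebra.
From mathcomp Require Import all_classical all_reals all_analysis.
From mathcomp Require Import ring lra.

(** In coordinates, K is the unit ball of a norm p, and a centered
    ellipsoid is the unit ball of a positive definite quadratic form.
    Translations gain nothing because K is symmetric, so the Banach-Mazur
    distance d of K to the ball is the least rho for which some form q
    satisfies p ^ 2 <= q <= rho ^ 2 * p ^ 2 ([banach_mazur_form_dist]). A
    compactness argument produces an optimal q ([form_dist_attained]).

    Suppose that two different forms A and B are optimal. Both their
    arithmetic mean and their harmonic mean are optimal as well: the upper
    bound q <= d ^ 2 * p ^ 2 is convex in q, and the lower bound p ^ 2 <=
    q is inherited by the harmonic mean because p is subadditive
    ([harmonic_mean_bound]). The harmonic mean H lies below the arithmetic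
    mean M, and the two agree at x exactly when x is in the kernel of A -
    B. For the form N = (H + M) / 2, which lies between them, one of the
    two inequalities can therefore be an equality only on this kernel, a
    proper subspace. If the section of K by the kernel had a smaller
    distance, then moving N slightly towards (an extension of) a better
    form for that section would make both inequalities strict everywhere:
    at the points of contact because the better form is strict there, and
    elsewhere by compactness. This would beat d. So the section by the
    kernel of A - B has the same distance d ([form_dist_restrict]), and an
    induction on the dimension ends at a section with a single optimal
    form ([exists_section_unique_form]).

    It remains to see that uniqueness of the optimal form implies
    uniqueness of the pair of distance ellipsoids, whose centers are a
    priori arbitrary. If the inner ellipsoid had a center c other than 0,
    then K would contain its translates by c and - c, hence an ellipsoid
    stretched in the direction of c, which would be a second optimal form
    ([inner_center]). If the outer ellipsoid had a center other than 0,
    then K would be in the intersection of two opposite translates, hence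
    in a smaller homothetic ellipsoid, against the minimality of d
    ([outer_center]). *)

Import Order.TTheory GRing.Theory Num.Theory numFieldNormedType.Exports.
Local Open Scope classical_set_scope.
Local Open Scope ring_scope.

Set Implicit Arguments.
Unset Strict Implicit.
Unset Printing Implicit Defensive.

(** * Quadratic forms *)

Section QuadraticForms.
Context {R : realType}.

Definition bil m (S : 'M[R]_m) (x y : 'rV[R]_m) : R :=
  (x *m S *m y^T) ord0 ord0.

Definition quad m (S : 'M[R]_m) (x : 'rV[R]_m) : R := bil S x x.

Lemma bilDl m (S : 'M[R]_m) x y z : bil S (x + y) z = bil S x z + bil S y z.
Proof. by rewrite /bil !mulmxDl mxE. Qed.

Lemma bilDr m (S : 'M[R]_m) x y z : bil S z (x + y) = bil S z x + bil S z y.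
Proof. by rewrite /bil linearD /= mulmxDr mxE. Qed.

Lemma bilZl m (S : 'M[R]_m) t x y : bil S (t *: x) y = t * bil S x y.
Proof. by rewrite /bil -!scalemxAl mxE. Qed.

Lemma bilZr m (S : 'M[R]_m) t x y : bil S x (t *: y) = t * bil S x y.
Proof. by rewrite /bil linearZ /= -scalemxAr mxE. Qed.

Lemma bilNl m (S : 'M[R]_m) x y : bil S (- x) y = - bil S x y.
Proof. by rewrite -scaleN1r bilZl mulN1r. Qed.

Lemma bilNr m (S : 'M[R]_m) x y : bil S x (- y) = - bil S x y.
Proof. by rewrite -scaleN1r bilZr mulN1r. Qed.

Lemma bilD m (S T : 'M[R]_m) x y : bil (S + T) x y = bil S x y + bil T x y.
Proof. by rewrite /bil mulmxDr mulmxDl mxE. Qed.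

Lemma bilZ m t (S : 'M[R]_m) x y : bil (t *: S) x y = t * bil S x y.
Proof. by rewrite /bil -scalemxAr -scalemxAl mxE. Qed.

Lemma bilN m (S : 'M[R]_m) x y : bil (- S) x y = - bil S x y.
Proof. by rewrite -scaleN1r bilZ mulN1r. Qed.

Lemma bil_pull m k (S : 'M[R]_m) (A : 'M[R]_(k, m)) x y :
  bil (A *m S *m A^T) x y = bil S (x *m A) (y *m A).
Proof. by rewrite /bil trmx_mul !mulmxA. Qed.

Lemma bilC m (S : 'M[R]_m) x y : S^T = S -> bil S x y = bil S y x.
Proof.
move=> sS; rewrite /bil.
have -> : y *m S *m x^T = (x *m S *m y^T)^T.
  by rewrite !trmx_mul trmxK sS mulmxA.
by rewrite [RHS]mxE.
Qed.

Lemma bil_delta m (S : 'M[R]_m) i j :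
  bil S (delta_mx ord0 i) (delta_mx ord0 j) = S i j.
Proof.
by rewrite /bil trmx_delta -colE -rowE !mxE.
Qed.

Lemma quadZ m (S : 'M[R]_m) t x : quad S (t *: x) = t ^+ 2 * quad S x.
Proof. by rewrite /quad bilZl bilZr mulrA. Qed.

Lemma quadN m (S : 'M[R]_m) x : quad S (- x) = quad S x.
Proof. by rewrite /quad bilNl bilNr opprK. Qed.

Lemma quad0 m (S : 'M[R]_m) : quad S 0 = 0.
Proof. by rewrite -[X in quad _ X](scale0r 0) quadZ expr0n mul0r. Qed.

Lemma quadD m (S : 'M[R]_m) x y : S^T = S ->
  quad S (x + y) = quad S x + 2 * bil S x y + quad S y.
Proof. by move=> sS; rewrite /quad !(bilDl, bilDr) (bilC y x sS); ring. Qed.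

Lemma quad_pull m k (S : 'M[R]_m) (A : 'M[R]_(k, m)) x :
  quad (A *m S *m A^T) x = quad S (x *m A).
Proof. exact: bil_pull. Qed.

Lemma tr_pull m k (S : 'M[R]_m) (A : 'M[R]_(k, m)) : S^T = S ->
  (A *m S *m A^T)^T = A *m S *m A^T.
Proof. by move=> sS; rewrite !trmx_mul sS trmxK mulmxA. Qed.

Lemma quad_add m (S T : 'M[R]_m) x : quad (S + T) x = quad S x + quad T x.
Proof. exact: bilD. Qed.

Lemma quad_scale m t (S : 'M[R]_m) x : quad (t *: S) x = t * quad S x.
Proof. exact: bilZ. Qed.

Lemma quad_opp m (S : 'M[R]_m) x : quad (- S) x = - quad S x.
Proof. exact: bilN. Qed.

Lemma quad1 m (x : 'rV[R]_m) : quad 1%:M x = \sum_i x ord0 i ^+ 2.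
Proof.
by rewrite /quad /bil mulmx1 mxE; apply: eq_bigr => i _; rewrite mxE expr2.
Qed.

Definition posdef m (S : 'M[R]_m) : Prop :=
  S^T = S /\ forall x, x != 0 -> 0 < quad S x.

Lemma posdef_ge0 m (S : 'M[R]_m) x : posdef S -> 0 <= quad S x.
Proof.
by move=> [_ pS]; have [->|/pS/ltW//] := eqVneq x 0; rewrite quad0.
Qed.

Lemma posdef_eq0 m (S : 'M[R]_m) x : posdef S -> quad S x = 0 -> x = 0.
Proof. by move=> [_ pS] q0; apply: contra_eq q0 => /pS; case: ltgtP. Qed.

Lemma posdef1 m : posdef (1%:M : 'M[R]_m).
Proof.
split=> [|x x0]; first exact: trmx1.
rewrite quad1 lt_def sumr_ge0 ?andbT => [|i _]; last exact: sqr_ge0.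
apply: contra x0; rewrite psumr_eq0 => [/allP h|i _]; last exact: sqr_ge0.
apply/eqP/rowP => i; rewrite mxE; apply/eqP; rewrite -sqrf_eq0.
by apply: h; rewrite mem_index_enum.
Qed.

Lemma posdef_pull m k (S : 'M[R]_m) (A : 'M[R]_(k, m)) :
  row_free A -> posdef S -> posdef (A *m S *m A^T).
Proof.
move=> fA [sS pS]; split; first exact: tr_pull.
move=> x x0; rewrite quad_pull; apply: pS.
apply: contra x0 => /eqP xA; rewrite -[x](mulmxKp fA) /= xA mul0mx //.
Qed.

Lemma unitmx_of_ker0 m (A : 'M[R]_m) :
  (forall x : 'rV_m, x *m A = 0 -> x = 0) -> A \in unitmx.
Proof.
move=> kA; rewrite -row_free_unit -kermx_eq0; apply/eqP/row_matrixP => i.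
by rewrite row0; apply: kA; rewrite -row_mul mulmx_ker row0.
Qed.

Lemma posdef_unit m (S : 'M[R]_m) : posdef S -> S \in unitmx.
Proof.
move=> pS; apply: unitmx_of_ker0 => x xS; apply: (posdef_eq0 pS).
by rewrite /quad /bil xS mul0mx mxE.
Qed.

(** Completing the square in the first coordinate leaves a positive definite
    form in the remaining ones. *)
Lemma cholesky m (S : 'M[R]_m) : posdef S ->
  exists2 Q : 'M[R]_m, Q \in unitmx & S = Q *m Q^T.
Proof.
move=> pS.
suff [Q SQ] : exists Q : 'M[R]_m, S = Q *m Q^T.
  exists Q => //; have := posdef_unit pS.
  by rewrite SQ unitmx_mul => /andP[].
elim: m S pS => [|m IH] S pS; first by exists 0; apply/matrixP => -[].
rewrite -[m.+1]/(1 + m)%N in S pS *.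
have [sS qS] := pS.
set a := ulsubmx S; set b := ursubmx S; set C := drsubmx S.
have eS : S = block_mx a b b^T C.
  rewrite -[LHS]submxK; congr block_mx.
  by rewrite -[in LHS]sS -trmx_ursub.
have sC : C^T = C by rewrite /C -[in RHS]sS trmx_drsub.
have qE (t : R) (y : 'rV[R]_m) : quad S (row_mx t%:M y) =
    t ^+ 2 * a 0 0 + 2 * t * (y *m b^T) 0 0 + quad C y.
  have bt : (b *m y^T) 0 0 = (y *m b^T) 0 0.
    by rewrite -[in RHS](trmxK y) -trmx_mul [RHS]mxE.
  rewrite eS /quad /bil mul_row_block tr_row_mx mul_row_col !mulmxDl.
  rewrite tr_scalar_mx !mul_scalar_mx -!scalemxAl !mul_mx_scalar.
  rewrite /quad /bil; move: bt; move: (b *m y^T) (y *m b^T) (y *m C *m y^T).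
  by move=> u v w uv; rewrite !mxE /= uv; ring.
have a0 : 0 < a 0 0.
  have z : ((0 : 'rV[R]_m) *m b^T) 0 0 = 0 by rewrite mul0mx mxE.
  have := qS (row_mx 1%:M 0); rewrite qE z quad0 expr1n mulr0 mul1r !addr0.
  apply; rewrite row_mx_eq0 negb_and.
  by rewrite -(scalemx1 1) scale1r oner_neq0.
pose C' := C - (a 0 0)^-1 *: (b^T *m b).
have [|Q eQ] := IH C'.
  split.
    by rewrite /C' linearB /= linearZ /= trmx_mul trmxK sC.
  move=> y y0.
  have := qS (row_mx (- (y *m b^T) 0 0 / a 0 0)%:M y).
  rewrite row_mx_eq0 (negPf y0) andbF => /(_ isT).
  rewrite qE /C' quad_add quad_opp quad_scale.
  have -> : quad (b^T *m b) y = ((y *m b^T) 0 0) ^+ 2.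
    by have := quad_pull 1%:M b^T y; rewrite mulmx1 trmxK quad1 big_ord1.
  set u := (y *m b^T) 0 0; set c := quad C y.
  congr (_ < _); field; exact: lt0r_neq0.
pose r := Num.sqrt (a 0 0).
have r0 : r != 0 by rewrite gt_eqF // sqrtr_gt0.
have rr : r * r = a 0 0 by rewrite -expr2 sqr_sqrtr // ltW.
exists (block_mx r%:M 0 (r^-1 *: b^T) Q).
rewrite tr_block_mx mulmx_block eS.
rewrite !(tr_scalar_mx, trmx0, mulmx0, mul0mx, addr0) linearZ /= trmxK.
rewrite mul_mx_scalar mul_scalar_mx -scalemxAl -scalemxAr.
rewrite !scalerA mul_mx_scalar scalerA mulfV // mulVf // !scale1r.
rewrite -scalemxAl scalerA -invfM rr -eQ /C' addrC subrK.
by rewrite scale_scalar_mx rr -mx11_scalar.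
Qed.

End QuadraticForms.

(** * Norms, quadratic forms and compactness *)

Section Norms.
Context {R : realType}.

Definition is_norm m (p : 'rV[R]_m -> R) : Prop :=
  [/\ forall x y, p (x + y) <= p x + p y,
      forall t x, p (t *: x) = `|t| * p x &
      forall x, p x = 0 -> x = 0].

Section NormTheory.
Context m (p : 'rV[R]_m -> R) (np : is_norm p).

Lemma norm_add x y : p (x + y) <= p x + p y.
Proof. by case: np. Qed.

Lemma norm_scale t x : p (t *: x) = `|t| * p x.
Proof. by case: np. Qed.

Lemma norm_zero : p 0 = 0.
Proof. by rewrite -[X in p X](scale0r 0) norm_scale normr0 mul0r. Qed.

Lemma norm_opp x : p (- x) = p x.
Proof. by rewrite -scaleN1r norm_scale normrN1 mul1r. Qed.

Lemma norm_ge0 x : 0 <= p x.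
Proof. by have := norm_add x (- x); rewrite subrr norm_zero norm_opp; lra. Qed.

Lemma norm_gt0 x : x != 0 -> 0 < p x.
Proof.
move=> x0; rewrite lt_def norm_ge0 andbT; apply: contra x0 => /eqP.
by case: np => _ _ h /h ->.
Qed.

Lemma norm_sqZ t x : p (t *: x) ^+ 2 = t ^+ 2 * p x ^+ 2.
Proof. by rewrite norm_scale exprMn real_normK ?num_real. Qed.

Lemma norm_sum (I : Type) (r : seq I) (F : I -> 'rV[R]_m) :
  p (\sum_(i <- r) F i) <= \sum_(i <- r) p (F i).
Proof.
elim/big_rec2: _ => [|i u v _ uv]; first by rewrite norm_zero.
by apply: le_trans (norm_add _ _) _; rewrite lerD2l.
Qed.

Lemma norm_pull k (G : 'M[R]_(k, m)) : row_free G ->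
  is_norm (fun z => p (z *m G)).
Proof.
move=> fG; split=> [x y|t x|x].
- by rewrite mulmxDl norm_add.
- by rewrite -scalemxAl norm_scale.
- by case: np => _ _ h /h xG; rewrite -[x](mulmxKp fG) /= xG mul0mx.
Qed.

End NormTheory.

Lemma coord_le_norm m (x : 'rV[R]_m) i : `|x ord0 i| <= `|x|.
Proof.
rewrite [leRHS]/Num.norm /= mx_normrE; apply/bigmax_geP; right => /=.
by exists (ord0, i).
Qed.

Lemma is_norm_continuous m (p : 'rV[R]_m -> R) : is_norm p -> continuous p.
Proof.
move=> np; pose C := \sum_i p (delta_mx ord0 i) + 1.
have C0 : 0 < C by rewrite ltr_wpDl // sumr_ge0 // => i _; exact: norm_ge0.
have bd x : p x <= C * `|x|.
  rewrite [x in p x]row_sum_delta (le_trans (norm_sum np _ _)) // /C mulrDl.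
  rewrite mul1r mulr_suml ler_wpDr // ler_sum // => i _.
  by rewrite norm_scale // mulrC ler_wpM2l ?norm_ge0 // coord_le_norm.
move=> x; apply/(cvgrPdist_le (F := nbhs x)) => e e0; apply/nbhs_ballP.
exists (e / C) => /=; first exact: divr_gt0.
move=> y; rewrite -ball_normE /= => /ltW.
rewrite ler_pdivlMr // mulrC => xy; apply: le_trans xy.
apply: le_trans (bd _); rewrite ler_norml; apply/andP; split.
  by have := norm_add np (y - x) x; rewrite subrK -opprB norm_opp //; lra.
by have := norm_add np (x - y) y; rewrite subrK; lra.
Qed.

Lemma norm_sq_continuous m (p : 'rV[R]_m -> R) : is_norm p ->
  continuous (fun x => p x ^+ 2).
Proof.
move=> np; have -> : (fun x => p x ^+ 2) = p \* p.
  by apply/funext => x; rewrite expr2.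
by move=> x; apply: continuousM; exact: is_norm_continuous.
Qed.

Lemma quad_continuous m (S : 'M[R]_m) : continuous (quad S).
Proof.
have -> : quad S = fun x => \sum_j (\sum_i x ord0 i * S i j) * x ord0 j.
  apply/funext => x; rewrite /quad /bil mxE; apply: eq_bigr => j _.
  by rewrite !mxE.
apply: continuous_big => [|j _ x]; first exact: add_continuous.
apply: continuousM; last exact: coord_continuous.
move: x; apply: continuous_big => [|i _ y]; first exact: add_continuous.
by apply: continuousM; [exact: coord_continuous|exact: cst_continuous].
Qed.

Lemma compact_min m (A : set 'rV[R]_m) (f : 'rV[R]_m -> R) :
  compact A -> A !=set0 -> continuous f ->
  exists2 c, A c & forall x, A x -> f c <= f x.
Proof.
move=> cA A0 cf; have [|c Ac cmin] := EVT_min_rV A0 cA (f := f).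
  exact: continuous_subspaceT.
exists c; first by rewrite inE in Ac.
by move=> x Ax; apply: cmin; rewrite inE.
Qed.

Lemma compact_sphere m : compact [set x : 'rV[R]_m | `|x| = 1].
Proof.
apply: bounded_closed_compact.
  by exists 1; split; [exact: num_real|move=> M M1 x /= ->; exact: ltW].
have -> : [set x : 'rV[R]_m | `|x| = 1] = (fun x => `|x|) @^-1` [set 1] by [].
apply: preimage_closed; last exact: closed_eq.
by move=> x _; exact: norm_continuous.
Qed.

Lemma continuous_opp (T : topologicalType) (f : T -> R) :
  continuous f -> continuous (fun x => - f x).
Proof. by move=> cf x; apply: (continuousN (V := R) (cf x)). Qed.

Lemma continuous_sub (T : topologicalType) (f g : T -> R) :
  continuous f -> continuous g -> continuous (fun x => f x - g x).
Proof. by move=> cf cg x; apply: (continuousB (V := R) (cf x) (cg x)). Qed.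

Lemma continuous_mull (T : topologicalType) (c : R) (f : T -> R) :
  continuous f -> continuous (fun x => c * f x).
Proof.
move=> cf x.
exact: (@continuousM R _ _ f x (@cst_continuous _ _ c x) (cf x)).
Qed.

Lemma closed_sublevel (T : topologicalType) (g : T -> R) : continuous g ->
  closed [set x | g x <= 0].
Proof.
move=> cg; rewrite -[X in closed X]/(g @^-1` [set x | x <= 0]).
by apply: preimage_closed => [x _|]; [exact: cg|exact: closed_le].
Qed.

(** A perturbation that is positive where a nonnegative function vanishes makes
    that function positive, by compactness of the sphere. *)
Lemma perturb_pos m (f g : 'rV[R]_m -> R) :
  continuous f -> continuous g ->
  (forall t x, f (t *: x) = t ^+ 2 * f x) ->
  (forall t x, g (t *: x) = t ^+ 2 * g x) ->
  (forall x, x != 0 -> 0 <= f x) ->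
  (forall x, x != 0 -> f x = 0 -> 0 < g x) ->
  exists2 e, 0 < e &
    forall d x, 0 < d -> d <= e -> x != 0 -> 0 < f x + d * g x.
Proof.
move=> cf cg hf hg f0 fg.
pose A := [set x : 'rV[R]_m | `|x| = 1] `&` [set x | g x <= 0].
have n0 (x : 'rV[R]_m) : `|x| = 1 -> x != 0.
  by move=> x1; rewrite -normr_eq0 x1 oner_eq0.
have cA : compact A.
  apply: compact_closedI; first exact: compact_sphere.
  exact: closed_sublevel.
suff [e e0 He] : exists2 e, 0 < e &
    forall d x, 0 < d -> d <= e -> A x -> 0 < f x + d * g x.
  exists e => // d x d0 de x0.
  pose y := `|x|^-1 *: x.
  have y1 : `|y| = 1 by rewrite normrZ normfV normr_id mulVf ?normr_eq0.
  have fgy : 0 < f y + d * g y.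
    have [gy|gy] := lerP (g y) 0; first exact: He.
    by rewrite ltr_wpDl ?f0 ?n0 // mulr_gt0.
  have nx : 0 < `|x| by rewrite normr_gt0.
  have -> : x = `|x| *: y by rewrite scalerA mulfV ?scale1r // gt_eqF.
  rewrite hf hg mulrCA -mulrDr mulr_gt0 // exprn_gt0 //.
have [A0|A0] := pselect (A !=set0); last first.
  by exists 1 => // d x _ _ Ax; case: A0; exists x.
have [c [c1 gc] fmin] := compact_min cA A0 cf.
have [b [b1 gb] gmin] := compact_min cA A0 cg.
have fc : 0 < f c.
  rewrite lt_def f0 ?n0 // andbT; apply/eqP => /(fg _ (n0 _ c1)).
  by rewrite ltNge gc.
have gb1 : 0 < 1 - g b by rewrite subr_gt0 (le_lt_trans gb).
exists (f c / (1 - g b)); first exact: divr_gt0.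
move=> d x d0; rewrite ler_pdivlMr // => dfc Ax.
have := fmin x Ax; have := gmin x Ax; rewrite -(ler_pM2l d0); nra.
Qed.

End Norms.

(** * The distance from a norm to the Euclidean norms *)

Section FormDistance.
Context {R : realType}.

Definition sandwich m (p : 'rV[R]_m -> R) (rho : R) (S : 'M[R]_m) : Prop :=
  S^T = S /\ forall x, p x ^+ 2 <= quad S x <= rho ^+ 2 * p x ^+ 2.

(** Sections of the unit ball of [p] correspond to restrictions of [p], and
    this number is their Banach-Mazur distance to the ball. *)
Definition form_dist m (p : 'rV[R]_m -> R) : R :=
  inf [set rho | 0 < rho /\ exists S, sandwich p rho S].

Lemma sandwich_posdef m (p : 'rV[R]_m -> R) rho S :
  is_norm p -> sandwich p rho S -> posdef S.
Proof.
move=> np [sS pS]; split=> // x x0; have /andP[h _] := pS x.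
by apply: lt_le_trans h; rewrite exprn_gt0 // norm_gt0.
Qed.

Lemma sandwich_pull m k (p : 'rV[R]_m -> R) rho S (G : 'M[R]_(k, m)) :
  sandwich p rho S -> sandwich (fun z => p (z *m G)) rho (G *m S *m G^T).
Proof.
move=> [sS pS]; split=> [|x]; first exact: tr_pull.
by rewrite quad_pull.
Qed.

Lemma form_dist_lb m (p : 'rV[R]_m -> R) :
  lbound [set rho | 0 < rho /\ exists S, sandwich p rho S] 0.
Proof. by move=> r [/ltW]. Qed.

Lemma form_dist_le m (p : 'rV[R]_m -> R) rho S :
  0 < rho -> sandwich p rho S -> form_dist p <= rho.
Proof.
move=> r0 sS; apply: ge_inf; first by exists 0; exact: form_dist_lb.
by split=> //; exists S.
Qed.

Section OfNorm.
Context m (p : 'rV[R]_m -> R) (np : is_norm p).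

(** Each of [p ^ 2] and the Euclidean form is bounded by a multiple of the
    other: subtracting a small multiple of one from the other keeps it
    positive. *)
Lemma ratios_nonempty : exists rho, 0 < rho /\ exists S, sandwich p rho S.
Proof.
have [e1 e10 h1] : exists2 e, 0 < e &
    forall d x, 0 < d -> d <= e -> x != 0 -> 0 < quad 1%:M x + d * - p x ^+ 2.
  apply: perturb_pos.
  - exact: quad_continuous.
  - by apply: continuous_opp; exact: norm_sq_continuous.
  - exact: quadZ.
  - by move=> t x; rewrite norm_sqZ // mulrN.
  - by move=> x _; apply: posdef_ge0; exact: posdef1.
  - by move=> x x0 /(posdef_eq0 (posdef1 m)) /eqP; rewrite (negPf x0).
have [e2 e20 h2] : exists2 e, 0 < e &
    forall d x, 0 < d -> d <= e -> x != 0 -> 0 < p x ^+ 2 + d * - quad 1%:M x.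
  apply: perturb_pos.
  - exact: norm_sq_continuous.
  - by apply: continuous_opp; exact: quad_continuous.
  - exact: norm_sqZ.
  - by move=> t x; rewrite quadZ // mulrN.
  - by move=> x _; exact: sqr_ge0.
  - by move=> x /(norm_gt0 np) px /eqP; rewrite sqrf_eq0 gt_eqF.
exists (Num.sqrt (e1 * e2)^-1); split.
  by rewrite sqrtr_gt0 invr_gt0 mulr_gt0.
exists (e1^-1 *: 1%:M); split; first by rewrite linearZ /= trmx1.
have e12 : 0 <= (e1 * e2)^-1 by rewrite invr_ge0 mulr_ge0 // ltW.
move=> x; rewrite sqr_sqrtr //.
have [->|x0] := eqVneq x 0.
  by rewrite quad0 norm_zero // expr0n /= mulr0 lexx.
have := h1 _ x e10 (lexx _) x0; have := h2 _ x e20 (lexx _) x0 => l2 l1.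
rewrite quad_scale invfM -mulrA ler_pM2l ?invr_gt0 // !ler_pdivlMl //.
by apply/andP; split; lra.
Qed.

Lemma form_dist_ge0 : 0 <= form_dist p.
Proof. by apply: lb_le_inf; [exact: ratios_nonempty|exact: form_dist_lb]. Qed.

Lemma form_dist_lt r : form_dist p < r ->
  exists rho S, [/\ 0 < rho, rho < r & sandwich p rho S].
Proof.
move=> /inf_lt [|rho [r0 [S sS]] rr]; first exact: ratios_nonempty.
by exists rho, S.
Qed.

Let entry (S : 'M[R]_m) i j : S^T = S -> 2 * S i j =
  quad S (delta_mx ord0 i + delta_mx ord0 j) -
  quad S (delta_mx ord0 i) - quad S (delta_mx ord0 j).
Proof. by move=> sS; rewrite quadD // bil_delta; ring. Qed.

(** The pairs of a squared ratio and a form admissible for it are the points of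
    a compact set, on which the squared ratio is a coordinate. *)
Lemma form_dist_attained : exists S, sandwich p (form_dist p) S.
Proof.
pose form (v : 'rV[R]_(1 + m * m)) : 'M[R]_m := vec_mx (rsubmx v).
pose sig (v : 'rV[R]_(1 + m * m)) : R := v ord0 (lshift _ ord0).
have cform i j : continuous (fun v => form v i j).
  have -> : (fun v => form v i j) =
      fun v => v ord0 (rshift 1 (mxvec_index i j)).
    by apply/funext => v; rewrite !mxE.
  exact: coord_continuous.
have csig : continuous sig by exact: coord_continuous.
have cquad x : continuous (fun v => quad (form v) x).
  have -> : (fun v => quad (form v) x) =
      fun v => \sum_j (\sum_i x ord0 i * form v i j) * x ord0 j.
    apply/funext => v; rewrite /quad /bil mxE; apply: eq_bigr => j _.
    by rewrite !mxE.
  apply: continuous_big => [|j _ v]; first exact: add_continuous.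
  apply: continuousM; last exact: cst_continuous.
  move: v; apply: continuous_big => [|i _ y]; first exact: add_continuous.
  by apply: continuousM; [exact: cst_continuous|exact: cform].
have [rho [r0 [S0 sS0]]] := ratios_nonempty.
pose A := [set v |
  (forall ij : 'I_m * 'I_m, form v ij.1 ij.2 - form v ij.2 ij.1 <= 0) /\
  ((forall x, p x ^+ 2 - quad (form v) x <= 0) /\
  ((forall x, quad (form v) x - sig v * p x ^+ 2 <= 0) /\
  (sig v - rho ^+ 2 <= 0 /\ - sig v <= 0)))].
have AP v : A v -> [/\ (form v)^T = form v,
    forall x, p x ^+ 2 <= quad (form v) x <= sig v * p x ^+ 2,
    sig v <= rho ^+ 2 & 0 <= sig v].
  move=> [h1 [h2 [h3 [h4 h5]]]]; split; [| |lra|lra].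
    apply/matrixP => i j; rewrite mxE; have := h1 (i, j); have := h1 (j, i).
    by move=> /=; lra.
  by move=> x; apply/andP; split; [have := h2 x|have := h3 x]; lra.
have closed_all (I : Type) (g : I -> 'rV[R]_(1 + m * m) -> R) :
    (forall i, continuous (g i)) -> closed [set v | forall i, g i v <= 0].
  move=> cg; have -> : [set v | forall i, g i v <= 0] =
     \bigcap_(i in setT) [set v | g i v <= 0].
    by apply/seteqP; split=> v /= h i; [move=> _; exact: h|exact: h].
  by apply: closed_bigI => i _; exact: closed_sublevel.
have cA : closed A.
  apply: closedI.
    by apply: closed_all => i; apply: continuous_sub; exact: cform.
  apply: closedI.
    apply: closed_all => x; apply: continuous_sub; last exact: cquad.
    exact: cst_continuous.
  apply: closedI.
    apply: closed_all => x; apply: continuous_sub; first exact: cquad.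
    by move=> v; apply: continuousM; [exact: csig|exact: cst_continuous].
  apply: closedI; apply: closed_sublevel.
    by apply: continuous_sub; [exact: csig|exact: cst_continuous].
  by apply: continuous_opp; exact: csig.
have bA : bounded_set A.
  pose P := \sum_i p (delta_mx ord0 i).
  have P0 : 0 <= P by apply: sumr_ge0 => i _; exact: norm_ge0.
  have pP i : p (delta_mx ord0 i) <= P.
    by rewrite /P (bigD1 i) //= lerDl sumr_ge0 // => j _; exact: norm_ge0.
  exists (rho ^+ 2 + rho ^+ 2 * (6 * P ^+ 2)); split; first exact: num_real.
  move=> M /ltW hM v /AP [sF qF s1 s0].
  have q0 x : 0 <= quad (form v) x.
    by have /andP[h _] := qF x; apply: le_trans h; exact: sqr_ge0.
  (* The entries of a form are controlled by its values, by polarization. *)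
  have qB x c : 0 <= c -> p x <= c -> quad (form v) x <= rho ^+ 2 * c ^+ 2.
    move=> c0 pc; have /andP[_ h] := qF x; apply: le_trans h _.
    by rewrite ler_pM ?sqr_ge0 // lerXn2r // nnegrE // norm_ge0.
  apply: le_trans hM; rewrite [leLHS]/Num.norm /= mx_normrE.
  have r20 : 0 <= rho ^+ 2 by exact: sqr_ge0.
  have P20 : 0 <= rho ^+ 2 * (6 * P ^+ 2)
    by rewrite mulr_ge0 // mulr_ge0 ?sqr_ge0.
  apply/bigmax_leP; split=> [|[i k] _ /=]; first exact: addr_ge0.
  rewrite ord1; case: (split_ordP k) => {}k ->.
    rewrite ord1 -/(sig v) ger0_norm //; lra.
  case/mxvec_indexP: k => a b.
  have -> : v ord0 (rshift 1 (mxvec_index a b)) = form v a b by rewrite !mxE.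
  pose x : 'rV[R]_m := delta_mx ord0 a; pose y : 'rV[R]_m := delta_mx ord0 b.
  have := entry a b sF; have := qB _ _ P0 (pP a); have := qB _ _ P0 (pP b).
  have := qB (x + y) (2 * P).
  rewrite mulr_ge0 // => /(_ isT); rewrite exprMn.
  have -> : p (x + y) <= 2 * P.
    apply: le_trans (norm_add np _ _) _; have := pP a; have := pP b.
    by rewrite -/x -/y; lra.
  move=> /(_ isT); rewrite -/x -/y.
  have := q0 x; have := q0 y; have := q0 (x + y).
  move: (quad _ (x + y)) (quad _ x) (quad _ y) => u w z.
  move: (rho ^+ 2) r20 {P20} => r2 r20.
  have := mulr_ge0 r20 (sqr_ge0 P); move: (P ^+ 2) => P2.
  by rewrite ler_norml; nra.
have kA : compact A by exact: bounded_closed_compact.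
pose emb S (s : R) : 'rV[R]_(1 + m * m) := row_mx s%:M (mxvec S).
have embF S s : form (emb S s) = S by rewrite /form row_mxKr mxvecK.
have embS S s : sig (emb S s) = s by rewrite /sig row_mxEl mxE.
have Aemb S s : sandwich p s S -> 0 < s -> s <= rho -> A (emb S (s ^+ 2)).
  move=> [sS qS] s0 sr.
  split=> [[i j]|] /=; first by rewrite embF -[in S i j]sS mxE subrr.
  rewrite embF embS; split; first by move=> x; have /andP[] := qS x; lra.
  split; first by move=> x; have /andP[] := qS x; lra.
  split; last by rewrite oppr_le0 sqr_ge0.
  by rewrite subr_le0 lerXn2r // nnegrE ltW.
have [|v Av vmin] := compact_min kA _ csig.
  by exists (emb S0 (rho ^+ 2)); exact: Aemb.
have [sF qF s1 s0] := AP _ Av.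
exists (form v); split=> // x; have /andP[-> h] := qF x; apply: le_trans h _.
rewrite ler_wpM2r ?sqr_ge0 // -[leLHS]sqr_sqrtr // lerXn2r ?nnegrE //.
  exact: form_dist_ge0.
apply: lb_le_inf; first exact: ratios_nonempty.
move=> r [rpos [S sS]].
suff sr : sig v <= r ^+ 2.
  by apply: le_trans (ler_wsqrtr sr) _; rewrite sqrtr_sqr ger0_norm // ltW.
have [rr|rr] := lerP r rho.
  by have := vmin _ (Aemb _ _ sS rpos rr); rewrite embS.
by apply: le_trans s1 _; rewrite lerXn2r // ?nnegrE ltW.
Qed.

End OfNorm.
End FormDistance.

(** * Two optimal forms reduce the dimension *)

Section Reduction.
Context {R : realType}.

(** The right-hand side is the harmonic mean of [M + D] and [M - D]: it
    is the value at [x] of the infimal convolution of the doubled forms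
    [2 (M + D)] and [2 (M - D)], attained at the splitting of [x] used here. *)
Lemma harmonic_mean_bound m (p : 'rV[R]_m -> R) (M D : 'M[R]_m) x :
  is_norm p -> posdef M -> D^T = D ->
  (forall y, p y ^+ 2 <= quad (M + D) y) ->
  (forall y, p y ^+ 2 <= quad (M - D) y) ->
  p x ^+ 2 <= quad M x - quad M (x *m D *m invmx M).
Proof.
move=> np pM sD pA pB; set w := x *m D *m invmx M.
have [sM _] := pM.
have wM y : bil M w y = bil D x y by rewrite /bil mulmxKV // posdef_unit.
pose y := 2^-1 *: (x - w); pose z := 2^-1 *: (x + w).
have xyz : x = y + z.
  by rewrite /y /z; move: (w) => u; apply/rowP => i; rewrite !mxE; field.
have h : p x ^+ 2 <= 2 * p y ^+ 2 + 2 * p z ^+ 2.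
  have := norm_add np y z; rewrite -xyz.
  have := norm_ge0 np x; have := norm_ge0 np y; have := norm_ge0 np z.
  have := sqr_ge0 (p y - p z); nra.
apply: le_trans h _.
have := pA y; have := pB z.
rewrite !quad_add quad_opp /y /z !quadZ !quadD // !quadN !bilNr.
have := wM w; have := wM x; rewrite -/(quad M w) -/(quad D x) (bilC w x sM).
have -> : (2^-1 : R) ^+ 2 = 4^-1 by field.
lra.
Qed.

(** The kernel of [A - B] contains every point at which one of the inequalities
    is an equality for the form [N] below, the mean of the arithmetic and the
    harmonic mean of [A] and [B]. A form that is better on this kernel would
    thus yield a small perturbation of [N] that is better on the whole space. *)
Lemma form_dist_restrict m (p : 'rV[R]_m -> R) (A B : 'M[R]_m) :
  is_norm p -> sandwich p (form_dist p) A -> sandwich p (form_dist p) B ->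
  A != B ->
  form_dist (fun z => p (z *m row_base (kermx (A - B)))) = form_dist p.
Proof.
move=> np hA hB AB; set G := row_base _; set d := form_dist p in hA hB *.
have fG : row_free G by exact: row_base_free.
have npG := norm_pull np fG.
have d0 : 0 <= d by exact: form_dist_ge0.
apply/eqP; rewrite eq_le; apply/andP; split.
  apply: lb_le_inf; first exact: ratios_nonempty.
  by move=> r [r0 [S /(sandwich_pull G) sS]]; exact: form_dist_le sS.
rewrite leNgt; apply/negP => /(form_dist_lt npG) [r [C [r0 rd [sC hC]]]].
have [sA qA] := hA; have [sB qB] := hB.
pose M := 2^-1 *: (A + B); pose D := 2^-1 *: (A - B).
have MDA : M + D = A.
  by apply/matrixP => i j; rewrite !mxE; field.
have MDB : M - D = B by apply/matrixP => i j; rewrite !mxE; field.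
have qM x : quad M x = (quad A x + quad B x) / 2.
  by rewrite quad_scale quad_add mulrC.
have sM : M^T = M by rewrite linearZ /= linearD /= sA sB.
have sD : D^T = D by rewrite linearZ /= linearB /= sA sB.
have pM : posdef M.
  split=> // x x0; rewrite qM.
  have [_ /(_ _ x0)] := sandwich_posdef np hA.
  by have [_ /(_ _ x0)] := sandwich_posdef np hB; lra.
have d2r2 : r ^+ 2 < d ^+ 2 by nra.
(* L is self-adjoint for M, and the harmonic mean of A and B maps x to
   quad M x - quad M (x *m L). *)
pose L := D *m invmx M.
pose N := M - 2^-1 *: (L *m M *m L^T).
have qN x : quad N x = quad M x - quad M (x *m L) / 2.
  rewrite quad_add quad_opp [X in _ - X]quad_scale quad_pull.
  by rewrite [X in _ - X]mulrC.
have lowN x : p x ^+ 2 + quad M (x *m L) / 2 <= quad N x.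
  have := @harmonic_mean_bound _ p M D x np pM sD.
  rewrite MDA MDB -mulmxA -/L => h; rewrite qN.
  suff : p x ^+ 2 <= quad M x - quad M (x *m L) by lra.
  by apply: h => y; [have /andP[] := qA y|have /andP[] := qB y].
have upN x : quad N x <= d ^+ 2 * p x ^+ 2 - quad M (x *m L) / 2.
  rewrite qN qM; have /andP[_] := qA x; have /andP[_] := qB x; lra.
have kerL x : quad M (x *m L) = 0 -> x = x *m pinvmx G *m G.
  move=> /(posdef_eq0 pM) xL; rewrite mulmxKpV // eq_row_base.
  apply/sub_kermxP.
  have : x *m D = 0 by rewrite -[D](mulmxKV (posdef_unit pM)) mulmxA xL mul0mx.
  rewrite /D -scalemxAr => /eqP; rewrite scaler_eq0 invr_eq0 pnatr_eq0 /=.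
  by move/eqP.
(* Rescaling the better form C by t makes its inequalities strict, the upper one
   with a margin de that survives in the final ratio. *)
pose t := (1 + d ^+ 2 / r ^+ 2) / 2.
have r20 : 0 < r ^+ 2 by rewrite exprn_gt0.
have t1 : 1 < t.
  have : 1 < d ^+ 2 / r ^+ 2 by rewrite ltr_pdivlMr // mul1r.
  rewrite /t; lra.
have tr : t * r ^+ 2 = (r ^+ 2 + d ^+ 2) / 2.
  by rewrite /t; field; exact: lt0r_neq0.
pose de := (d ^+ 2 - r ^+ 2) / 4.
have de0 : 0 < de by rewrite /de; lra.
(* The pseudo-inverse of G extends C from the kernel to the whole space. *)
pose C' := t *: (pinvmx G *m C *m (pinvmx G)^T).
have sC' : C'^T = C' by rewrite linearZ /= tr_pull.
have sN : N^T = N by rewrite linearB /= [X in _ - X]linearZ /= tr_pull // sM.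
have qC' x : quad M (x *m L) = 0 -> x != 0 ->
    p x ^+ 2 < quad C' x /\ quad C' x + de * p x ^+ 2 < d ^+ 2 * p x ^+ 2.
  move=> /kerL ex x0; rewrite quad_scale quad_pull.
  have := hC (x *m pinvmx G); rewrite -ex => /andP[l u].
  have := norm_gt0 np x0; move: (p x) l u => px l u px0.
  have px20 : 0 < px ^+ 2 by rewrite exprn_gt0.
  split; first by nra.
  have : t * quad C (x *m pinvmx G) <= t * (r ^+ 2 * px ^+ 2).
    by rewrite ler_pM2l //; lra.
  rewrite mulrA tr /de; nra.
have qL0 x : 0 <= quad M (x *m L) by exact: posdef_ge0.
have csq2 := norm_sq_continuous np.
have csq (c : R) : continuous (fun x => c * p x ^+ 2).
  exact: continuous_mull.
have [e1 e10 h1] : exists2 e, 0 < e & forall s x, 0 < s -> s <= e -> x != 0 ->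
    0 < (quad N x - p x ^+ 2) + s * (quad C' x - quad N x).
  apply: perturb_pos.
  - by apply: continuous_sub; [exact: quad_continuous|exact: csq2].
  - by apply: continuous_sub; exact: quad_continuous.
  - by move=> a x; rewrite quadZ norm_sqZ // mulrBr.
  - by move=> a x; rewrite !quadZ mulrBr.
  - by move=> x _; have := lowN x; have := qL0 x; lra.
  - move=> x x0 e; have qL : quad M (x *m L) = 0.
      by have := lowN x; have := qL0 x; lra.
    by have [] := qC' x qL x0; lra.
have [e2 e20 h2] : exists2 e, 0 < e & forall s x, 0 < s -> s <= e -> x != 0 ->
    0 < (d ^+ 2 * p x ^+ 2 - quad N x) +
      s * (quad N x - quad C' x - de * p x ^+ 2).
  apply: perturb_pos.
  - by apply: continuous_sub; [exact: csq|exact: quad_continuous].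
  - apply: continuous_sub; last exact: csq.
    by apply: continuous_sub; exact: quad_continuous.
  - by move=> a x; rewrite quadZ norm_sqZ //; ring.
  - by move=> a x; rewrite !quadZ norm_sqZ //; ring.
  - by move=> x _; have := upN x; have := qL0 x; lra.
  - move=> x x0 e; have qL : quad M (x *m L) = 0.
      by have := upN x; have := qL0 x; lra.
    by have [] := qC' x qL x0; lra.
pose s := Num.min e1 e2.
have s0 : 0 < s by rewrite lt_min e10.
pose N' := N + s *: (C' - N).
have qN' x : quad N' x = quad N x + s * (quad C' x - quad N x).
  by rewrite (quad_add N) (quad_scale s) (quad_add C') (quad_opp N).
have sN' : N'^T = N'.
  have trE (X Y : 'M[R]_m) : (X + s *: (Y - X))^T = X^T + s *: (Y^T - X^T).
    by rewrite linearD /= linearZ /= linearB.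
  by rewrite trE sN sC'.
have [x x0] : exists x : 'rV[R]_m, x != 0.
  apply/not_existsP => h; case/negP: AB; apply/eqP/row_matrixP => i.
  have := h (row i (A - B)); rewrite linearB /= subr_eq0 => /negP.
  by rewrite negbK => /eqP.
have bd y : y != 0 -> p y ^+ 2 < quad N' y < (d ^+ 2 - s * de) * p y ^+ 2.
  move=> y0; rewrite qN'.
  have := h1 s y s0; rewrite ge_min lexx => /(_ isT y0).
  have := h2 s y s0; rewrite ge_min lexx orbT => /(_ isT y0).
  by move=> l u; apply/andP; split; lra.
have px : 0 < p x ^+ 2 by rewrite exprn_gt0 // norm_gt0.
have ds0 : 0 < d ^+ 2 - s * de.
  by have /andP[l u] := bd x x0; rewrite -(pmulr_lgt0 _ px); lra.
pose r' := Num.sqrt (d ^+ 2 - s * de).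
have r'2 : r' ^+ 2 = d ^+ 2 - s * de by rewrite sqr_sqrtr // ltW.
have r'0 : 0 < r' by rewrite sqrtr_gt0.
have : d <= r'.
  apply: (form_dist_le r'0 (S := N')); split=> // y.
  have [->|/bd/andP[/ltW-> /ltW]] := eqVneq y 0; last by rewrite r'2.
  by rewrite quad0 norm_zero // expr0n /= mulr0 lexx.
have := mulr_gt0 s0 de0; nra.
Qed.

End Reduction.

(** A form that is not the only optimal one can be traded for a proper
    subspace of the same distance, which must stop for reasons of dimension. *)
Lemma exists_section_unique_form (R : realType) m (p : 'rV[R]_m -> R) :
  is_norm p ->
  exists k (G : 'M[R]_(k, m)), [/\ row_free G,
    form_dist (fun z => p (z *m G)) = form_dist p &
    forall S T, sandwich (fun z => p (z *m G)) (form_dist p) S ->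
      sandwich (fun z => p (z *m G)) (form_dist p) T -> S = T].
Proof.
elim/ltn_ind: m p => m IH p np.
have [uniq|] := pselect (forall S T, sandwich p (form_dist p) S ->
    sandwich p (form_dist p) T -> S = T).
  exists m, 1%:M; have -> : (fun z => p (z *m 1%:M)) = p.
    by apply/funext => z; rewrite mulmx1.
  by split=> //; rewrite row_free_unit unitmx1.
move/existsNP => [A /existsNP[B /not_implyP[hA /not_implyP[hB AB]]]].
have {}AB : A != B by apply/eqP.
have eqd := form_dist_restrict np hA hB AB.
have lt_k : (\rank (kermx (A - B)%R) < m)%N.
  have rAB : (0 < \rank (A - B)%R)%N by rewrite lt0n mxrank_eq0 subr_eq0.
  rewrite mxrank_ker ltn_subrL rAB; exact: leq_trans rAB (rank_leq_row _).
have fG : row_free (row_base (kermx (A - B))) by exact: row_base_free.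
move: (row_base _) eqd fG => G eqd fG.
have [k [H [fH eH uH]]] := IH _ lt_k _ (norm_pull np fG).
have pHG : (fun z => p (z *m (H *m G))) = (fun z => p (z *m H *m G)).
  by apply/funext => z; rewrite mulmxA.
exists k, (H *m G); rewrite pHG -eqd; split=> //.
apply/row_freeP; exists (pinvmx G *m pinvmx H).
by rewrite mulmxA -[H *m G *m _]mulmxA mulmxVp // mulmx1 mulmxVp.
Qed.

(** * Concentricity *)

Section Concentric.
Context {R : realType} (m : nat) (p : 'rV[R]_m -> R) (np : is_norm p).

Lemma norm_le_of_ball (Q : 'M[R]_m) :
  (forall x, quad Q x <= 1 -> p x <= 1) -> forall x, p x ^+ 2 <= quad Q x.
Proof.
move=> h x; have [->|x0] := eqVneq x 0.
  by rewrite quad0 norm_zero // expr0n.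
have px := norm_gt0 np x0.
rewrite leNgt; apply/negP => lt_q.
(* Rescaling puts x on the ellipsoid, or far outside the unit ball of p if the
   form is not positive at x. *)
have [q0|q0] := lerP (quad Q x) 0.
  have := h ((2 / p x) *: x).
  rewrite quadZ norm_scale // ger0_norm ?divr_ge0 ?norm_ge0 //.
  rewrite mulfVK ?gt_eqF //.
  have := sqr_ge0 (2 / p x); move: (_ ^+ 2) => s s0.
  have sq : s * quad Q x <= 1 by nra.
  by move=> /(_ sq); lra.
pose s := Num.sqrt (quad Q x).
have s0 : 0 < s by rewrite sqrtr_gt0.
have s2 : s ^+ 2 = quad Q x by rewrite sqr_sqrtr // ltW.
have := h (s^-1 *: x).
have s1 : 0 <= s^-1 by rewrite invr_ge0 ltW.
rewrite quadZ norm_scale // (ger0_norm s1) exprVn s2.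
rewrite mulVf ?gt_eqF // lexx => /(_ isT).
rewrite ler_pdivrMl // mulr1 => ps.
by move: lt_q; rewrite -s2; nra.
Qed.

Lemma ball_le_of_norm (Q : 'M[R]_m) c :
  (forall x, p x <= 1 -> quad Q x <= c) -> forall x, quad Q x <= c * p x ^+ 2.
Proof.
move=> h x; have [->|x0] := eqVneq x 0.
  by rewrite quad0 norm_zero // expr0n mulr0.
have px := norm_gt0 np x0.
have := h ((p x)^-1 *: x).
have p1 : 0 <= (p x)^-1 by rewrite invr_ge0 ltW.
rewrite norm_scale // (ger0_norm p1) mulVf ?gt_eqF // lexx.
by move=> /(_ isT); rewrite quadZ exprVn mulrC ler_pdivrMr ?exprn_gt0.
Qed.

(** The unit ball of [p] contains the convex hull of the two translates of the
    ellipsoid by [c] and [- c], hence the ellipsoid stretched in the direction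
    of [c]. *)
Lemma inner_center (S : 'M[R]_m) rho c :
  sandwich p rho S -> (forall T, sandwich p rho T -> T = S) ->
  (forall x, quad S (x - c) <= 1 -> p x <= 1) -> c = 0.
Proof.
move=> hS uS hc; have pS := sandwich_posdef np hS; have [sS qS] := hS.
have [//|c0] := eqVneq c 0.
have g0 : 0 < quad S c by have [_ ->] := pS.
(* A point x of the stretched ellipsoid, that of T, is t *: c plus a point of
   the ellipsoid of S, where t := th * bil S x c; the value of th ensures that
   |t| <= 1. *)
pose g := quad S c; pose th := (1 + 2 * g)^-1; pose de := th * (2 - th * g).
pose T := S - de *: ((c *m S)^T *m (c *m S)).
have g1 : 0 < 1 + 2 * g by rewrite /g; lra.
have th0 : 0 < th by rewrite invr_gt0.
have thg : th * (1 + 2 * g) = 1 by rewrite mulVf // gt_eqF.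
have de0 : 0 < de by rewrite mulr_gt0 //; rewrite -/g in g0; nra.
have qT x : quad T x = quad S x - de * bil S x c ^+ 2.
  rewrite quad_add quad_opp quad_scale; congr (_ - _ * _).
  have := quad_pull 1%:M (c *m S)^T x.
  rewrite mulmx1 trmxK quad1 big_ord1 => ->.
  by rewrite trmx_mul sS mulmxA.
suff hT : sandwich p rho T.
  have := qT c; rewrite (uS _ hT) -/(quad S c) -/g => h.
  by rewrite -/g in g0; exfalso; have := mulr_gt0 de0 (exprn_gt0 2 g0); lra.
split=> [|x].
  have uu (u : 'rV[R]_m) : (u^T *m u)^T = u^T *m u by rewrite trmx_mul trmxK.
  by rewrite /T linearB /= linearZ /= uu sS.
apply/andP; split; last first.
  have /andP[_] := qS x; rewrite qT; have := sqr_ge0 (bil S x c); nra.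
move: x; apply: norm_le_of_ball => x; rewrite qT.
set b := bil S x c => le1.
pose t := th * b.
have qd y : quad S (x - y *: c) = quad S x - 2 * y * b + y ^+ 2 * g.
  by rewrite quadD // quadN quadZ bilNr bilZr -/b -/g; ring.
(* Cauchy-Schwarz. *)
have cs : b ^+ 2 <= quad S x * g.
  have := posdef_ge0 (x - (b / g) *: c) pS; rewrite qd.
  have -> : quad S x - 2 * (b / g) * b + (b / g) ^+ 2 * g =
      quad S x - b ^+ 2 / g.
    by field; exact: lt0r_neq0.
  by rewrite subr_ge0 ler_pdivrMr.
have t1 : t ^+ 2 <= 1.
  have k0 : 0 < (1 - th * g) ^+ 2 by rewrite exprn_gt0 //; lra.
  have kE : (1 - th * g) ^+ 2 = 1 - de * g by rewrite /de; ring.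
  have bg : b ^+ 2 * (1 - th * g) ^+ 2 <= g.
    by rewrite kE; rewrite -/g in g0; nra.
  have tg : th ^+ 2 * g <= (1 - th * g) ^+ 2.
    have -> : th ^+ 2 * g = th * (th * g) by ring.
    have -> : th * g = (1 - th) / 2 by lra.
    by nra.
  rewrite -(ler_pM2r k0) mul1r exprMn -mulrA; apply: le_trans tg.
  by rewrite ler_pM2l // exprn_gt0.
have qt : quad S (x - t *: c) <= 1.
  by rewrite qd; apply: le_trans le1; rewrite /t /de -/b; nra.
have p1 : p (x - t *: c + c) <= 1 by apply: hc; rewrite addrK.
have p2 : p (x - t *: c - c) <= 1.
  by rewrite -(norm_opp np) opprD opprK; apply: hc; rewrite addrK quadN.
have -> : x =
    ((1 + t) / 2) *: (x - t *: c + c) + ((1 - t) / 2) *: (x - t *: c - c).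
  by apply/rowP => i; rewrite !mxE; field.
apply: le_trans (norm_add np _ _) _; rewrite !norm_scale //.
have [tl tu] : -1 <= t /\ t <= 1 by split; nra.
rewrite !ger0_norm; [nra|lra|lra].
Qed.

(** Averaging the bounds at [x] and [- x] by the parallelogram law. *)
Lemma quad_centered (S : 'M[R]_m) c r : S^T = S ->
  (forall x, p x <= 1 -> quad S (x - c) <= r) ->
  forall x, p x <= 1 -> quad S x <= r - quad S c.
Proof.
move=> sS hc x px.
have := hc x px; have := hc (- x); rewrite norm_opp // => /(_ px).
by rewrite !quadD // !quadN !bilNr bilNl; lra.
Qed.

(** The gain [quad S c] in the averaged bound would beat the optimal ratio. *)
Lemma outer_center (S : 'M[R]_m) c :
  sandwich p (form_dist p) S ->
  (forall x, p x <= 1 -> quad S (x - c) <= form_dist p ^+ 2) -> c = 0.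
Proof.
move=> hS hc; have pS := sandwich_posdef np hS; have [sS qS] := hS.
have [//|c0] := eqVneq c 0.
set d := form_dist p in hS hc qS *.
have g0 : 0 < quad S c by have [_ ->] := pS.
have q1 x : quad S x <= (d ^+ 2 - quad S c) * p x ^+ 2.
  by move: x; apply: ball_le_of_norm; exact: quad_centered.
have pc : 0 < p c ^+ 2 by rewrite exprn_gt0 // norm_gt0.
have r0 : 0 < d ^+ 2 - quad S c.
  by have := q1 c; have /andP[] := qS c; nra.
have := form_dist_le (p := p) (rho := Num.sqrt (d ^+ 2 - quad S c)) (S := S).
rewrite sqrtr_gt0 => /(_ r0) h.
have r2 : Num.sqrt (d ^+ 2 - quad S c) ^+ 2 = d ^+ 2 - quad S c.
  by rewrite sqr_sqrtr // ltW.
have {}h : d <= Num.sqrt (d ^+ 2 - quad S c).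
  apply: h; split=> // x; rewrite r2 q1 andbT; by have /andP[] := qS x.
have d0 : 0 <= d by exact: form_dist_ge0.
suff : quad S c <= 0 by rewrite leNgt g0.
by nra.
Qed.

End Concentric.

(** * The norm with a given unit ball *)

Section Gauge.
Context {R : realType} (n : nat) (K : set 'rV[R]_n).
Hypotheses (K_body : convex_body K) (K_sym : origin_symmetric K).

Definition gauge (x : 'rV[R]_n) : R := inf [set t | 0 < t /\ K (t^-1 *: x)].

Lemma body_convex x y t : K x -> K y -> 0 <= t -> t <= 1 ->
  K (t *: x + (1 - t) *: y).
Proof.
move=> Kx Ky t0 t1; have [cK _ _] := K_body.
have := cK x y (Itv01 t0 t1); rewrite !inE; exact.
Qed.

Lemma body_opp x : K x -> K (- x).
Proof. by move=> Kx; rewrite K_sym; exists x. Qed.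

(** An interior point of a symmetric convex body and its opposite have the
    origin as their midpoint. *)
Lemma body_ball : exists2 r, 0 < r & forall y, `|y| < r -> K y.
Proof.
have [_ _ [z /nbhs_ballP[r /= r0 zr]]] := K_body.
exists r => // y yr.
have zy : K (z + y).
  by apply: zr; rewrite -ball_normE /= opprD addNKr normrN.
have yz : K (y - z).
  rewrite -opprB; apply: body_opp; apply: zr; rewrite -ball_normE /=.
  by rewrite opprB addrCA subrr addr0.
have := @body_convex (z + y) (y - z) 2^-1 zy yz.
have -> : 2^-1 *: (z + y) + (1 - 2^-1) *: (y - z) = y.
  by apply/rowP => i; rewrite !mxE; field.
by apply; lra.
Qed.

Lemma body0 : K 0.
Proof. by have [r r0 Kr] := body_ball; apply: Kr; rewrite normr0. Qed.

Lemma body_shrink t x : K x -> 0 <= t -> t <= 1 -> K (t *: x).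
Proof.
by move=> Kx t0 t1; have := body_convex Kx body0 t0 t1; rewrite scaler0 addr0.
Qed.

Lemma gauge_set_nonempty x : [set t | 0 < t /\ K (t^-1 *: x)] !=set0.
Proof.
have [r r0 Kr] := body_ball.
have n0 : 0 < `|x| + 1 by rewrite ltr_wpDl.
exists ((`|x| + 1) / r); split; first exact: divr_gt0.
apply: Kr; rewrite normrZ invf_div ger0_norm; last by rewrite divr_ge0 // ltW.
by rewrite mulrAC ltr_pdivrMr // ltr_pM2l // ltrDl.
Qed.

Lemma gauge_ge0 x : 0 <= gauge x.
Proof.
by apply: lb_le_inf; [exact: gauge_set_nonempty|move=> t [/ltW]].
Qed.

(** The infimum is attained because [K] is closed: [K] contains all proper
    shrinkings of [t^-1 *: x], hence that point as well. *)
Lemma gauge_leP t x : 0 < t -> gauge x <= t <-> K (t^-1 *: x).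
Proof.
move=> t0; split=> [xt|Kx]; last first.
  by apply: ge_inf; [exists 0 => s [/ltW]|split].
set y := t^-1 *: x.
have Ky l : 0 <= l -> l < 1 -> K (l *: y).
  rewrite le_eqVlt => /predU1P[<- _|l0 l1].
    by rewrite scale0r; exact: body0.
  have [|s [s0 Ks] st] := @inf_lt _ _ (t / l) (gauge_set_nonempty x).
    by apply: le_lt_trans xt _; rewrite ltr_pdivlMr // gtr_pMr.
  have -> : l *: y = (l * s / t) *: (s^-1 *: x).
    by rewrite /y !scalerA; congr (_ *: _); field; rewrite !lt0r_neq0.
  apply: body_shrink => //; first by rewrite divr_ge0 ?mulr_ge0 // ltW.
  by rewrite ler_pdivrMr // mul1r mulrC -ler_pdivlMr // ltW.
have [_ cK _] := K_body.
have clK : closed K by apply: compact_closed cK; exact: norm_hausdorff.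
apply: clK => B /nbhs_ballP[e /= e0 yB].
have ey : 0 < e + `|y| by rewrite ltr_wpDr.
pose l := 1 - e / (e + `|y|).
have le1 : e / (e + `|y|) <= 1 by rewrite ler_pdivrMr // mul1r lerDl.
have lt0 : 0 < e / (e + `|y|) by rewrite divr_gt0.
exists (l *: y); split; first by apply: Ky; rewrite /l; lra.
apply: yB; rewrite -ball_normE /=.
have -> : y - l *: y = (e / (e + `|y|)) *: y.
  by rewrite -[X in X - _]scale1r -scalerBl /l opprB addrC subrK.
rewrite normrZ ger0_norm ?(ltW lt0) // mulrAC ltr_pdivrMr // ltr_pM2l //.
by rewrite ltrDr.
Qed.

Lemma gauge_norm : is_norm gauge.
Proof.
have [_ cK _] := K_body.
have eq_pos (a b : R) : 0 <= a -> 0 <= b ->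
    (forall t, 0 < t -> a <= t <-> b <= t) -> a = b.
  move=> a0 b0 h; apply/eqP; rewrite eq_le; apply/andP; split.
    apply/ler_addgt0Pr => e e0; apply/h; first exact: ltr_wpDl.
    by rewrite lerDl ltW.
  apply/ler_addgt0Pr => e e0; apply/h; first exact: ltr_wpDl.
  by rewrite lerDl ltW.
split.
- move=> x y; apply/ler_addgt0Pr => e e0.
  pose t := gauge x + e / 2; pose u := gauge y + e / 2.
  have t0 : 0 < t by rewrite ltr_wpDl ?gauge_ge0 // divr_gt0.
  have u0 : 0 < u by rewrite ltr_wpDl ?gauge_ge0 // divr_gt0.
  have Kx : K (t^-1 *: x).
    by apply/gauge_leP => //; rewrite lerDl ltW // divr_gt0.
  have Ky : K (u^-1 *: y).
    by apply/gauge_leP => //; rewrite lerDl ltW // divr_gt0.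
  have tu : 0 < t + u by exact: addr_gt0.
  have -> : gauge x + gauge y + e = t + u by rewrite /t /u; field.
  apply/gauge_leP => //.
  have -> : (t + u)^-1 *: (x + y) =
      (t / (t + u)) *: (t^-1 *: x) + (1 - t / (t + u)) *: (u^-1 *: y).
    rewrite scalerDr !scalerA; congr (_ *: _ + _ *: _); field;
    by rewrite ?lt0r_neq0.
  apply: body_convex => //; first exact: divr_ge0 (ltW t0) (ltW tu).
  by rewrite ler_pdivrMr // mul1r lerDl ltW.
- move=> s x; have [->|s0] := eqVneq s 0.
    rewrite scale0r normr0 mul0r; apply: eq_pos => //; first exact: gauge_ge0.
    move=> t t0; split=> _; first exact: ltW.
    by apply/gauge_leP => //; rewrite scaler0; exact: body0.
  have s1 : 0 < `|s| by rewrite normr_gt0.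
  apply: eq_pos; [exact: gauge_ge0|by rewrite mulr_ge0 ?gauge_ge0|].
  move=> t t0; rewrite mulrC -ler_pdivlMr //.
  have H := gauge_leP (s *: x) t0; have H' := gauge_leP x (divr_gt0 t0 s1).
  suff : K (t^-1 *: (s *: x)) <-> K ((t / `|s|)^-1 *: x) by tauto.
  rewrite scalerA invf_div [t^-1 * s]mulrC.
  have [sp|sp] := ger0P s; first by [].
  by rewrite mulNr scaleNr; split=> /body_opp; rewrite ?opprK.
- move=> x gx; apply/eqP; rewrite -normr_le0; apply/ler_addgt0Pl => e e0.
  have [M [_ /(_ (`|M| + 1))]] := compact_bounded cK.
  have M1 : M < `|M| + 1 by rewrite (le_lt_trans (ler_norm M)) // ltrDl.
  move=> /(_ M1) KM; have M0 : 0 < `|M| + 1 by rewrite ltr_wpDl.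
  have eM : 0 < e / (`|M| + 1) by exact: divr_gt0.
  have /(gauge_leP _ eM)/KM : gauge x <= e / (`|M| + 1) by rewrite gx ltW.
  rewrite /= normrZ invf_div ger0_norm; last by rewrite divr_ge0 // ltW.
  by rewrite mulrAC ler_pdivrMr // ler_pM2l // addr0.
Qed.

Lemma gauge_ball : K = [set x | gauge x <= 1].
Proof.
by apply/seteqP; split=> x /=; rewrite (gauge_leP x ltr01) invr1 scale1r.
Qed.

End Gauge.

(** * Ellipsoids and Banach-Mazur distance in coordinates *)

Lemma translate0 (R : realType) (V : lmodType R) (A : set V) :
  translate 0 A = A.
Proof.
apply/seteqP; split=> [_ [x Ax <-]|x Ax]; first by rewrite addr0.
by exists x; rewrite ?addr0.
Qed.

(** The mutually inverse maps [f] and [g] are coordinates on [V], and [E] is the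
    form whose unit ball is the reference ball [B] of [V]. *)
Section Coordinates.
Context {R : realType} (V : vectType R) (k : nat).
Context (f : {linear 'rV[R]_k -> V}) (g : {linear V -> 'rV[R]_k}).
Hypotheses (fK : cancel f g) (gK : cancel g f).
Context (E : 'M[R]_k) (pE : posdef E).

Let B : set V := [set v | quad E (g v) <= 1].

Lemma operator_ball (T : 'End(V)) : bijective T ->
  exists2 S, posdef S & T @` B = [set v | quad S (g v) <= 1].
Proof.
move=> /bij_inj injT; pose J := lin1_mx (g \o T \o f).
have JE v : g (T v) = g v *m J by rewrite mul_rV_lin1 /= gK.
have uJ : J \in unitmx.
  apply: unitmx_of_ker0 => x xJ.
  have fx0 : f x = 0 by apply/injT/(can_inj gK); rewrite JE fK xJ !linear0.
  by rewrite -[x]fK fx0 linear0.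
exists (invmx J *m E *m (invmx J)^T).
  by apply: posdef_pull => //; rewrite row_free_unit unitmx_inv.
apply/seteqP; split=> [_ [w Bw <-]|v] /=.
  by rewrite quad_pull JE mulmxK.
rewrite quad_pull => qv; exists (f (g v *m invmx J)); first by rewrite /B /= fK.
by apply: (can_inj gK); rewrite JE fK mulmxKV.
Qed.

(** Cholesky factors of [S] and [E] both map to the standard form, so one
    followed by the inverse of the other maps [B] to the ellipsoid of [S]. *)
Lemma ball_operator (S : 'M[R]_k) : posdef S ->
  exists2 T : 'End(V), bijective T & T @` B = [set v | quad S (g v) <= 1].
Proof.
move=> /cholesky[Q uQ eQ]; have [P uP eP] := cholesky pE.
have qS x : quad S x = quad 1%:M (x *m Q) by rewrite -quad_pull mulmx1 eQ.
have qE x : quad E x = quad 1%:M (x *m P) by rewrite -quad_pull mulmx1 eP.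
pose J := P *m invmx Q.
have uJ : J \in unitmx by rewrite unitmx_mul uP unitmx_inv.
pose T : 'End(V) := linfun (f \o mulmxr J \o g).
have TE v : T v = f (g v *m J) by rewrite lfunE.
exists T.
  exists (fun v => f (g v *m invmx J)) => v; rewrite TE !fK.
    by rewrite mulmxK ?gK.
  by rewrite mulmxKV ?gK.
have JQ y : y *m J *m Q = y *m P by rewrite /J mulmxA mulmxKV.
apply/seteqP; split=> [_ [w Bw <-]|v] /=.
  by rewrite TE fK qS JQ -qE.
move=> qv; exists (f (g v *m invmx J)); last by rewrite TE fK mulmxKV ?gK.
by rewrite /B /= fK qE -JQ -qS mulmxKV.
Qed.

(** Every translation in the definition of the distance is removed by averaging
    an inclusion with its image under [- id]. *)
Lemma banach_mazur_form_dist (p : 'rV[R]_k -> R) : is_norm p ->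
  banach_mazur [set v | p (g v) <= 1] B = form_dist p.
Proof.
move=> np; congr inf; apply/seteqP; split=> rho /= [r0].
  move=> [T [/operator_ball[S pS TB] [u [v [KT TK]]]]]; split=> //.
  have [sS _] := pS.
  have q1 x : p x <= 1 -> quad S x <= 1.
    pose c := g (T v - u).
    suff h y : p y <= 1 -> quad S (y - c) <= 1.
      move=> px; apply: le_trans (quad_centered np sS h px) _.
      by rewrite gerBl posdef_ge0.
    move=> py.
    have /KT[_ [b Bb <-]] : translate u [set v | p (g v) <= 1] (f y + u).
      by exists (f y) => //=; rewrite fK.
    rewrite linearD /= => e.
    have : (T @` B) (f y - (T v - u)).
      by exists b => //; rewrite opprB addrA -e addrK.
    by rewrite TB /= linearB /= fK.
  have p1 x : quad S x <= 1 -> p x <= rho.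
    pose c := g (rho *: u - T v).
    suff h y : quad S y <= 1 -> p (y - c) <= rho.
      move=> qx; have h1 := h _ qx.
      have h2 : p (- x - c) <= rho by apply: h; rewrite quadN.
      have : p (x + x) <= rho + rho.
        have -> : x + x = (x - c) - (- x - c).
          by rewrite opprB opprK addrA subrK.
        apply: le_trans (norm_add np _ _) _; rewrite norm_opp //; exact: lerD.
      rewrite -mulr2n -scaler_nat norm_scale // ger0_norm //; lra.
    move=> qy; have [b Bb bE] : (T @` B) (f y) by rewrite TB /= fK.
    have [|_ [w /= pw <-] wE] := TK (T (b + v)).
      by exists (b + v) => //; exists b.
    have -> : y - c = rho *: g w.
      rewrite -linearZ /= /c -[y]fK -linearB /=; congr (g _).
      rewrite -bE opprB addrA -(linearD T) /= -wE scalerDr addrK //.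
    by rewrite norm_scale // gtr0_norm // ger_pMr.
  exists (rho ^+ 2 *: S); split; first by rewrite linearZ /= sS.
  move=> x; apply/andP; split.
    move: x; apply: norm_le_of_ball => // x.
    rewrite quad_scale -quadZ => /p1; rewrite norm_scale // gtr0_norm //.
    by rewrite ger_pMr.
  rewrite quad_scale ler_pM2l ?exprn_gt0 // -[leRHS]mul1r.
  exact: ball_le_of_norm.
move=> [S hS]; split=> //.
have [sS qS] := hS; have pS := sandwich_posdef np hS.
have [|T bT TB] := @ball_operator (rho ^- 2 *: S).
  split=> [|x x0]; first by rewrite linearZ /= sS.
  by rewrite quad_scale mulr_gt0 ?invr_gt0 ?exprn_gt0 //; have [_ ->] := pS.
exists T; split=> //; exists 0, 0; rewrite !translate0 TB.
split=> x /=; rewrite quad_scale ler_pdivrMl ?exprn_gt0 // mulr1.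
  move=> px; have /andP[_ /le_trans->//] := qS (g x).
  by rewrite ger_pMr ?exprn_gt0 // exprn_ile1 // norm_ge0.
move=> qx; exists (rho^-1 *: x); last first.
  by rewrite scalerA mulfV ?scale1r // gt_eqF.
rewrite /= linearZ /= norm_scale // gtr0_norm ?invr_gt0 //.
rewrite ler_pdivrMl // mulr1.
have /andP[/le_trans/(_ qx) h _] := qS (g x); have := norm_ge0 np (g x); nra.
Qed.

End Coordinates.

Section DistanceEllipsoids.
Context {R : realType} (n : nat) (U : {vspace 'rV[R]_n}) (k : nat).
Context (f : {linear 'rV[R]_k -> subvs_of U}).
Context (g : {linear subvs_of U -> 'rV[R]_k}).
Hypotheses (fK : cancel f g) (gK : cancel g f).
Context (E : 'M[R]_k) (pE : posdef E).
Hypothesis ballE :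
  section_in U (euclidean_ball R n) = [set v | quad E (g v) <= 1].

Lemma ellipsoid_form (X : set (subvs_of U)) : ellipsoid X ->
  exists S c, posdef S /\ X = [set v | quad S (g v - c) <= 1].
Proof.
move=> [T [/(operator_ball fK gK pE)[S pS TB] [c ->]]].
rewrite ballE TB; exists S, (g c); split=> //.
apply/seteqP; split=> [_ [w /= qw <-]|v /= qv].
  by rewrite linearD addrK.
by exists (v - c); rewrite /= ?subrK // linearB.
Qed.

Lemma form_ellipsoid (S : 'M[R]_k) : posdef S ->
  ellipsoid [set v : subvs_of U | quad S (g v) <= 1].
Proof.
move=> /(ball_operator fK gK pE)[T bT TB].
exists T; split=> //; exists 0; rewrite ballE TB.
apply/seteqP; split=> [v qv|_ [v qv <-]]; last by rewrite addr0.
by exists v => //; rewrite addr0.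
Qed.

(** The form of the inner ellipsoid of any pair is optimal, hence the same for
    all pairs; both centers vanish, and the outer ellipsoid is determined by the
    inner one. *)
Lemma unique_distance_ellipsoids (p : 'rV[R]_k -> R) : is_norm p ->
  (forall S T, sandwich p (form_dist p) S -> sandwich p (form_dist p) T ->
     S = T) ->
  exists! X, distance_ellipsoids [set v : subvs_of U | p (g v) <= 1] X.
Proof.
move=> np uniq; have [S hS] := form_dist_attained np.
have pS := sandwich_posdef np hS; have [sS qS] := hS.
have bmE : banach_mazur [set v : subvs_of U | p (g v) <= 1]
    (section_in U (euclidean_ball R n)) = form_dist p.
  by rewrite ballE; have := banach_mazur_form_dist fK gK pE np.
rewrite /distance_ellipsoids bmE.
set d := form_dist p in hS qS uniq *.
have d0 : 0 <= d by exact: form_dist_ge0.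
pose E1 := [set v : subvs_of U | quad S (g v) <= 1].
pose E2 := [set v : subvs_of U | quad S (g v) <= d ^+ 2].
(* This case occurs in dimension 0 only. *)
have flat : d = 0 -> forall x, quad S x = 0.
  move=> dz x; apply/eqP; rewrite eq_le (posdef_ge0 _ pS) andbT.
  by have /andP[_] := qS x; rewrite dz expr0n mul0r.
have E2E : E2 = dilate d E1.
  apply/seteqP; split=> [v qv|_ [w qw <-]]; last first.
    rewrite /E2 /= linearZ /= quadZ -[leRHS]mulr1.
    by rewrite ler_wpM2l ?sqr_ge0.
  have [dz|dn] := eqVneq d 0.
    exists 0; first by rewrite /E1 /= linear0 quad0.
    by rewrite scaler0 -[v]gK (posdef_eq0 pS (flat dz (g v))) linear0.
  exists (d^-1 *: v); last by rewrite scalerA mulfV ?scale1r.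
  rewrite /E1 /= linearZ /= quadZ exprVn ler_pdivrMl ?mulr1 //.
  by rewrite exprn_gt0 // lt_def dn.
exists (E1, E2); split=> [|[X1 X2]] /=.
  split=> /=.
  - exact: form_ellipsoid.
  - have [dz|dn] := eqVneq d 0.
      have -> : E2 = E1.
        apply/seteqP; split=> v _;
        by rewrite /E1 /E2 /= flat // ?sqr_ge0 ?ler01.
      exact: form_ellipsoid.
    have d2 : 0 < d ^+ 2 by rewrite exprn_gt0 // lt_def dn.
    have -> : E2 = [set v | quad (d ^- 2 *: S) (g v) <= 1].
      by apply/seteqP; split=> v; rewrite /E2 /= quad_scale ler_pdivrMl ?mulr1.
    apply: form_ellipsoid; split=> [|x x0]; first by rewrite linearZ /= sS.
    by rewrite quad_scale mulr_gt0 ?invr_gt0 //; have [_ ->] := pS.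
  - move=> v /= qv; have /andP[/le_trans/(_ qv) h _] := qS (g v).
    by have := norm_ge0 np (g v); nra.
  - move=> v /= pv; rewrite /E2 /=; have /andP[_ /le_trans->//] := qS (g v).
    by rewrite -[leRHS]mulr1 ler_wpM2l ?sqr_ge0 // exprn_ile1 // norm_ge0.
  - by exists 0; rewrite translate0.
move=> [/= /ellipsoid_form[T [c [pT ->]]] _ X1K KX2 [c2 eX2]].
have [sT _] := pT.
have in1 x : quad T (x - c) <= 1 -> p x <= 1.
  by move=> qx; have := X1K (f x); rewrite /= fK; apply.
have out1 x : p x <= 1 -> quad T (x - (g c2 + d *: c)) <= d ^+ 2.
  move=> px; have := KX2 (f x); rewrite eX2 /= fK => /(_ px).
  move=> [_ [w /= qw <-] /(congr1 g)]; rewrite fK linearD linearZ /= => <-.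
  have -> : d *: g w + g c2 - (g c2 + d *: c) = d *: (g w - c).
    by rewrite scalerBr opprD addrA addrK.
  by rewrite quadZ -[leRHS]mulr1 ler_wpM2l ?sqr_ge0.
have hT : sandwich p d T.
  split=> // x; apply/andP; split; move: x.
    apply: norm_le_of_ball => // x qx.
    have h1 : p (x + c) <= 1 by apply: in1; rewrite addrK.
    have h2 : p (x - c) <= 1.
      by rewrite -norm_opp // opprB addrC; apply: in1; rewrite addrK quadN.
    have := norm_add np (x + c) (x - c).
    have -> : x + c + (x - c) = 2 *: x.
      by rewrite addrACA subrr addr0 scaler_nat mulr2n.
    rewrite norm_scale // ger0_norm //; lra.
  apply: ball_le_of_norm => // x px.
  apply: le_trans (quad_centered np sT out1 px) _.
  by rewrite gerBl posdef_ge0.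
have c0 : c = 0.
  by apply: (inner_center np hT _ in1) => T' hT'; exact: uniq.
have c20 : c2 = 0.
  have := outer_center np hT out1; rewrite c0 scaler0 addr0 => e.
  by rewrite -[c2]gK e linear0.
have -> : X2 = E2.
  rewrite eX2 c20 translate0 E2E; congr dilate.
  by apply/seteqP; split=> v; rewrite /E1 /= c0 subr0 (uniq _ _ hT hS).
congr pair.
by apply/seteqP; split=> v; rewrite /E1 /= c0 subr0 (uniq _ _ hT hS).
Qed.

End DistanceEllipsoids.

Unset Implicit Arguments.

Theorem theorem2p6 (R : realType) (n : nat) (K : set 'rV[R]_n)
    (K_body : convex_body K) (K_sym : origin_symmetric K) :
  exists U : {vspace 'rV[R]_n},
    banach_mazur (section_in U K) (section_in U (euclidean_ball R n)) =
      banach_mazur K (euclidean_ball R n) /\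
    exists! E : set (subvs_of U) * set (subvs_of U),
      distance_ellipsoids (section_in U K) E.
Proof.
have np := gauge_norm K_body K_sym.
have KE := gauge_ball K_body K_sym.
move: (gauge K) np KE => p np KE.
have [k [G [fG dG uG]]] := exists_section_unique_form np.
pose U : {vspace 'rV[R]_n} := limg (linfun (mulmxr G)).
have UG z : z *m G \in U.
  by apply/memv_imgP; exists z; rewrite ?memvf // lfunE.
pose f : {linear 'rV[R]_k -> subvs_of U} := vsproj U \o mulmxr G.
pose g : {linear subvs_of U -> 'rV[R]_k} := mulmxr (pinvmx G) \o vsval.
have fE z : vsval (f z) = z *m G by rewrite /= vsprojK.
have fK : cancel f g by move=> z; rewrite /g /= vsprojK // mulmxKp.
have valE v : vsval v = g v *m G.
  have /memv_imgP[z _ vz] := subvsP v.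
  by rewrite /g /= vz lfunE /= mulmxKp.
have gK : cancel g f by move=> v; apply: (can_inj vsvalK); rewrite fE -valE.
have pE : posdef (G *m 1%:M *m G^T) by apply: posdef_pull => //; exact: posdef1.
have ballE : section_in U (euclidean_ball R n) =
    [set v | quad (G *m 1%:M *m G^T) (g v) <= 1].
  by apply/seteqP; split=> v; rewrite /section_in /= quad_pull -valE quad1.
have secE : section_in U K = [set v | p (g v *m G) <= 1].
  by rewrite KE; apply/seteqP; split=> v; rewrite /section_in /= -valE.
have npG := norm_pull np fG.
exists U; split.
  rewrite ballE secE (banach_mazur_form_dist fK gK pE npG) dG.
  have bmp := banach_mazur_form_dist (f := idfun) (g := idfun)
    (fun=> erefl) (fun=> erefl) (posdef1 n) np.
  rewrite [in RHS]KE -bmp.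
  congr banach_mazur; apply/seteqP.
  by split=> v /=; rewrite quad1.
rewrite secE.
apply: (unique_distance_ellipsoids fK gK pE ballE npG) => S T.
by rewrite dG; exact: uG.
Qed.
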